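(* Let $G=(V,E)$ be a hypergraph, and consider the multilinear set $\mathcal{S}_G$. Then $\mathrm{MP}^{\mathrm{EF}}_G\subseteq\mathrm{MP}^{\mathrm{RMC}}_G$ for all recursive McCormick relaxations (RMCs) of $\mathcal{S}_G$.
   Context: A hypergraph $G=(V,E)$ consists of a finite set $V$ of nodes and a set $E$ of subsets of $V$ of cardinality at least two, called edges. The rank of $G$ is $r=\max\{|e| : e\in E\}$. Throughout, $r\ge 3$ and every node belongs to at least one edge. Two distinct edges are adjacent if they have nonempty intersection. The multilinear set of $G$ is $$\mathcal{S}_G=\Big\{z\in\{0,1\}^{V+E} : z_e=\prod_{v\in e} z_v,\ \forall e\in E\Big\}.$$ Standard linearization: $\mathrm{MP}^{\mathrm{LP}}_G$ is the set of $z\in\mathbb{R}^{V+E}$ such that $z_v\le 1$ for all $v\in V$; and $z_e\ge 0$, $z_e\ge\sum_{v\in e}z_v-|e|+1$ for all $e\in E$; and $z_e\le z_v$ for all $v\in e$ and all $e\in E$. Extended flower relaxation. Let $e_0\in E$ and let $e_k$, $k\in K$, be the set of all edges adjacent to $e_0$. Let $T$ be a nonempty subset of $K$ such that $$\Big|(e_0 \cap e_i)\setminus \bigcup_{j \in T \setminus \{i\}}(e_0 \cap e_j)\Big| \geq 2, \quad \forall i \in T.$$ The extended flower inequality centered at $e_0$ with neighbors $e_k$, $k\in T$, is $$\sum_{v \in e_0\setminus \bigcup_{k\in T} e_k} z_v+\sum_{k \in T} z_{e_k} - z_{e_0} \leq \Big|e_0\setminus \bigcup_{k\in T} e_k\Big|+|T|-1.$$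 The extended flower relaxation $\mathrm{MP}^{\mathrm{EF}}_G$ is the polytope obtained by adding to $\mathrm{MP}^{\mathrm{LP}}_G$ all extended flower inequalities centered at each edge of $G$ (for all such nonempty $T$). Recursive McCormick relaxation (RMC). An RMC of $\mathcal{S}_G$ is obtained by recursively decomposing each multilinear term into bilinear ones. It is specified by a set $\bar E$ of subsets of $V$ of cardinality at least two with $E\cap\bar E=\emptyset$ (the artificial edges, each $e\in\bar E$ having an artificial variable $z_e$), and, for each $L\in E\cup\bar E$, one chosen partition $P_L=\{J,K\}$ of $L$ into two nonempty sets ($J\cup K=L$, $J\cap K=\emptyset$); the same partition $P_L$ is used wherever $L$ is decomposed. For each $e\in E$, the recursive sequence $\mathcal{R}_e$ is the smallest family of sets such that $e\in\mathcal{R}_e$ and, whenever $L\in\mathcal{R}_e$ with $L\in\{e\}\cup\bar E$ and $P_L=\{J,K\}$, each of $J,K$ that has cardinality greater than one also belongs to $\mathcal{R}_e$ (so an edge $L \in E$ with $L\neq e$ that appears in $\mathcal{R}_e$ is not decomposed further within $\mathcal{R}_e$). The set $\bar E$ consists exactly of the sets that occur in $\bigcup_{e\in E}\mathcal{R}_e$ and are not in $E$. Writing $z_{\{v\}}:=z_v$ for $v\in V$, the RMC is the polyhedron in the variables $z_p$, $p\in V\cup E\cup\bar E$, defined by the inequalities $$z_{L}\ge 0,\quad z_{L}\ge z_J+z_K-1,\quad z_{L}\le z_J,\quad z_{L}\le z_K,\qquad \forall L\in E\cup\bar E,\ P_L=\{J,K\}.$$ $\mathrm{MP}^{\mathrm{RMC}}_G$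 denotes the projection of the RMC onto the space of the original variables $z_p$, $p\in V\cup E$. *)

(* Defs.v *)
From HB Require Import structures.
From mathcomp Require Import all_boot all_order all_algebra.
From mathcomp Require Import reals.

Set Implicit Arguments.
Unset Strict Implicit.
Unset Printing Implicit Defensive.

Import Order.TTheory GRing.Theory Num.Theory.
Local Open Scope ring_scope.

Record hypergraph (V : finType) := Hypergraph {
  edges : {set {set V}};
  edges_card : forall e, e \in edges -> (1 < #|e|)%N
}.

Definition rank (V : finType) (G : hypergraph V) : nat :=
  (\max_(e in edges G) #|e|)%N.

Definition covers_nodes (V : finType) (G : hypergraph V) : Prop :=
  forall v : V, exists2 e, e \in edges G & v \in e.

(* The space R^(V + F), for a family F of subsets of V: the coordinate z_v is
   [z (inl v)], and the coordinate z_e of e \in F is [z (inr e)]. *)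
Definition point (R : realType) (V : finType) (F : {set {set V}}) :=
  {ffun V + {e : {set V} | e \in F} -> R}.

Definition edge (V : finType) (G : hypergraph V) :=
  {e : {set V} | e \in edges G}.

Definition adjacent (V : finType) (G : hypergraph V) (e f : edge G) : bool :=
  (e != f) && (val e :&: val f != set0).

Definition MP_LP (R : realType) (V : finType) (G : hypergraph V)
    (z : point R (edges G)) : Prop :=
  (forall v : V, z (inl v) <= 1) /\
  (forall e : edge G,
    [/\ 0 <= z (inr e),
        \sum_(v in val e) z (inl v) - #|val e|%:R + 1 <= z (inr e)
      & forall v, v \in val e -> z (inr e) <= z (inl v)]).

Definition flower_neighbors (V : finType) (G : hypergraph V) (e0 : edge G)
    (T : {set edge G}) : Prop :=
  [/\ T != set0,
      forall i, i \in T -> adjacent e0 i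
    & forall i, i \in T ->
        (2 <= #|(val e0 :&: val i)
                  :\: \bigcup_(j in T :\ i) (val e0 :&: val j)|)%N].

Definition extended_flower_ineq (R : realType) (V : finType)
    (G : hypergraph V) (e0 : edge G) (T : {set edge G})
    (z : point R (edges G)) : Prop :=
  let U := val e0 :\: \bigcup_(k in T) val k in
  \sum_(v in U) z (inl v) + \sum_(k in T) z (inr k) - z (inr e0)
    <= #|U|%:R + #|T|%:R - 1.

Definition MP_EF (R : realType) (V : finType) (G : hypergraph V)
    (z : point R (edges G)) : Prop :=
  MP_LP z /\
  (forall (e0 : edge G) (T : {set edge G}),
     flower_neighbors e0 T -> extended_flower_ineq e0 T z).

(* The recursive sequence R_e: A is the family of artificial edges and P L is
   the partition chosen for L. An edge L <> e of the hypergraph reached from e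
   is not decomposed further, as it does not belong to e |: A. *)
Inductive rec_seq (V : finType) (A : {set {set V}})
    (P : {set V} -> {set {set V}}) (e : {set V}) : {set V} -> Prop :=
| RecSeqRoot : rec_seq A P e e
| RecSeqPart (L J : {set V}) :
    rec_seq A P e L -> L \in e |: A -> J \in P L -> (1 < #|J|)%N ->
    rec_seq A P e J.

(* The combinatorial data of a recursive McCormick relaxation. Values of
   [rmc_split] outside of E :|: rmc_art are irrelevant. *)
Record rmc (V : finType) (G : hypergraph V) := Rmc {
  rmc_art : {set {set V}};
  rmc_split : {set V} -> {set {set V}};
  rmc_art_card : forall L, L \in rmc_art -> (1 < #|L|)%N;
  rmc_art_disjoint : [disjoint edges G & rmc_art];
  rmc_split_partition : forall L, L \in edges G :|: rmc_art ->
    partition (rmc_split L) L /\ #|rmc_split L| = 2%N;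
  rmc_artP : forall L, L \in rmc_art <->
    (exists2 e, e \in edges G & rec_seq rmc_art rmc_split e L)
      /\ L \notin edges G
}.

(* z_J for a set J that is either in F or a singleton [set v], in which case
   z_J stands for z_v. The value 0 for other sets is a dummy: every part of a
   partition chosen in an RMC is a singleton or belongs to F := E :|: rmc_art. *)
Definition zset (R : realType) (V : finType) (F : {set {set V}})
    (z : point R F) (J : {set V}) : R :=
  if insub J is Some e then z (inr e)
  else if [pick v | J == [set v]] is Some v then z (inl v)
  else 0.

Definition RMC (R : realType) (V : finType) (G : hypergraph V) (D : rmc G)
    (z : point R (edges G :|: rmc_art D)) : Prop :=
  forall L, L \in edges G :|: rmc_art D ->
  forall J K, rmc_split D L = [set J; K] -> J != K ->
    [/\ 0 <= zset z L,
        zset z J + zset z K - 1 <= zset z L,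
        zset z L <= zset z J
      & zset z L <= zset z K].

Definition widen_edge (V : finType) (F A : {set {set V}})
    (e : {e : {set V} | e \in F}) : {e : {set V} | e \in F :|: A} :=
  exist _ (val e) (subsetP (subsetUl F A) (val e) (valP e)).

Definition proj (R : realType) (V : finType) (F A : {set {set V}})
    (z : point R (F :|: A)) : point R F :=
  [ffun p => match p with
             | inl v => z (inl v)
             | inr e => z (inr (widen_edge A e))
             end].

Definition MP_RMC (R : realType) (V : finType) (G : hypergraph V) (D : rmc G)
    (z : point R (edges G)) : Prop :=
  exists2 w : point R (edges G :|: rmc_art D), RMC w & proj w = z.

(* Main.v *)
Require Import Defs.
From mathcomp Require Import all_boot all_order all_algebra.
From mathcomp Require Import reals.
From mathcomp Require Import lra.

(** Call a pair (U, T) of a set U of nodes and a set T of edges a cover of a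
    set L of nodes if every node of L lies in U or in some edge of T, and let
    its cost at z be the sum of 1 - z_p over the members p of U and T.  Let
    c(L) be the minimum of 1 and of the costs of all covers of L.

    The numbers w_L := 1 - c(L) satisfy every McCormick inequality, whatever
    partition L = J + K is chosen: w_L >= 0 because c <= 1; w_L <= w_J because
    a cover of L covers J ([cover_cost_mono]); and w_L >= w_J + w_K - 1 because
    a cover of J and a cover of K together cover L ([cover_cost_subadd]).
    Hence w is a point of every RMC, and only w_p = z_p for the original
    variables remains.  For a node v this holds since z_e <= z_v for every
    edge e containing v ([cover_cost_node]).

    For an edge e0 it says that no cover of e0 costs less than 1 - z_{e0}
    ([edge_le_cost]), and this is where the extended flower inequalities enter.
    If some e_i in T has at most one node of e0 that no other member of T
    contains, e_i may be replaced in the cover by this node (or dropped)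
    without increasing the cost.  When no such e_i is left, T is empty or T
    contains e0 or T is an admissible set of neighbors for e0, and the bound is
    respectively the standard linearization inequality, trivial, or the
    extended flower inequality. *)

Set Implicit Arguments.
Unset Strict Implicit.
Unset Printing Implicit Defensive.

Import Order.TTheory GRing.Theory Num.Theory.
Local Open Scope ring_scope.

(** * Sums of nonnegative terms over finite sets *)

Lemma sum_setU_le (R : numDomainType) (I : finType) (F : I -> R)
    (A B : {set I}) :
  (forall i, 0 <= F i) ->
  \sum_(i in A :|: B) F i <= \sum_(i in A) F i + \sum_(i in B) F i.
Proof.
move=> F0; rewrite [X in X <= _](big_setID A) /= setUK lerD2l.
rewrite setDUl setDv set0U [X in _ <= X](big_setID A) /= lerDr.
by apply: sumr_ge0.
Qed.

Lemma sum_subset_le (R : numDomainType) (I : finType) (F : I -> R)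
    (A B : {set I}) :
  (forall i, 0 <= F i) -> A \subset B ->
  \sum_(i in A) F i <= \sum_(i in B) F i.
Proof.
move=> F0 /setIidPr sAB; rewrite [X in _ <= X](big_setID A) /= sAB lerDl.
by apply: sumr_ge0.
Qed.

Lemma le_sum_mem (R : numDomainType) (I : finType) (F : I -> R)
    (A : {set I}) (i : I) :
  (forall j, 0 <= F j) -> i \in A -> F i <= \sum_(j in A) F j.
Proof. by move=> F0 iA; rewrite (big_setD1 i) //= lerDl; apply: sumr_ge0. Qed.

(** * Coordinates of points of the standard linearization *)

Lemma MP_LP_edge_le (R : realType) (V : finType) (G : hypergraph V)
    (z : point R (edges G)) (e : edge G) (v : V) :
  MP_LP z -> v \in val e -> z (inr e) <= z (inl v).
Proof. by case=> _ /(_ e)[_ _ +]; apply. Qed.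

Lemma MP_LP_edge_ge0 (R : realType) (V : finType) (G : hypergraph V)
    (z : point R (edges G)) (e : edge G) :
  MP_LP z -> 0 <= z (inr e).
Proof. by case=> _ /(_ e)[]. Qed.

Lemma MP_LP_le1 (R : realType) (V : finType) (G : hypergraph V)
    (z : point R (edges G)) (p : V + edge G) :
  MP_LP z -> z p <= 1.
Proof.
move=> zLP; have [zv1 _] := zLP; case: p => [v|e]; first exact: zv1.
have /card_gt0P[v ve] : (0 < #|val e|)%N by apply: ltnW; apply: edges_card (valP e).
exact: le_trans (MP_LP_edge_le zLP ve) (zv1 v).
Qed.

Lemma MP_LP_node_ge0 (R : realType) (V : finType) (G : hypergraph V)
    (z : point R (edges G)) (v : V) :
  covers_nodes G -> MP_LP z -> 0 <= z (inl v).
Proof.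
move=> cov zLP; have [e eG ve] := cov v.
apply: le_trans (@MP_LP_edge_ge0 _ _ _ _ (exist _ e eG) zLP) _.
exact: MP_LP_edge_le.
Qed.

(** * Covers and their costs *)

(** The pair [C] of a set of nodes and a set of edges covers [L]. *)
Definition covers (V : finType) (G : hypergraph V) (L : {set V})
    (C : {set V} * {set edge G}) : bool :=
  L \subset C.1 :|: \bigcup_(k in C.2) val k.

(** The sum of [1 - z_p] over the nodes and edges [p] of [C]. *)
Definition cost (R : realType) (V : finType) (G : hypergraph V)
    (z : point R (edges G)) (C : {set V} * {set edge G}) : R :=
  \sum_(v in C.1) (1 - z (inl v)) + \sum_(k in C.2) (1 - z (inr k)).

(** The least cost of a cover of [L], truncated at 1: the truncation makes
    [1 - cover_cost z L], the value of the lifted variable, nonnegative. *)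
Definition cover_cost (R : realType) (V : finType) (G : hypergraph V)
    (z : point R (edges G)) (L : {set V}) : R :=
  \big[Order.min/1]_(C : {set V} * {set edge G} | covers L C) cost z C.

Lemma compl_ge0 (R : realType) (V : finType) (G : hypergraph V)
    (z : point R (edges G)) (p : V + edge G) :
  MP_LP z -> 0 <= 1 - z p.
Proof. by move=> zLP; rewrite subr_ge0 MP_LP_le1. Qed.

Lemma cost_ge0 (R : realType) (V : finType) (G : hypergraph V)
    (z : point R (edges G)) (C : {set V} * {set edge G}) :
  MP_LP z -> 0 <= cost z C.
Proof. by move=> zLP; rewrite addr_ge0 ?sumr_ge0 // => *; apply: compl_ge0. Qed.

Lemma cover_cost_le (R : realType) (V : finType) (G : hypergraph V)
    (z : point R (edges G)) (L : {set V}) (C : {set V} * {set edge G}) :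
  covers L C -> cover_cost z L <= cost z C.
Proof. by move=> LC; apply: bigmin_le_cond. Qed.

Lemma cover_cost_le1 (R : realType) (V : finType) (G : hypergraph V)
    (z : point R (edges G)) (L : {set V}) :
  cover_cost z L <= 1.
Proof. exact: bigmin_le_id. Qed.

Lemma le_cover_cost (R : realType) (V : finType) (G : hypergraph V)
    (z : point R (edges G)) (L : {set V}) (x : R) :
  x <= 1 -> (forall C, covers L C -> x <= cost z C) -> x <= cover_cost z L.
Proof. by move=> x1 xC; apply/bigmin_geP; split. Qed.

Lemma cover_cost_mono (R : realType) (V : finType) (G : hypergraph V)
    (z : point R (edges G)) (J L : {set V}) :
  J \subset L -> cover_cost z J <= cover_cost z L.
Proof.
move=> sJL; apply: le_cover_cost => [|C LC]; first exact: cover_cost_le1.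
by apply: cover_cost_le; apply: subset_trans LC.
Qed.

Lemma cover_cost_ge0 (R : realType) (V : finType) (G : hypergraph V)
    (z : point R (edges G)) (L : {set V}) :
  MP_LP z -> 0 <= cover_cost z L.
Proof.
by move=> zLP; apply: le_cover_cost => [|C _]; [exact: ler01|exact: cost_ge0].
Qed.

Lemma cover_cost_subadd (R : realType) (V : finType) (G : hypergraph V)
    (z : point R (edges G)) (J K : {set V}) :
  MP_LP z -> cover_cost z (J :|: K) <= cover_cost z J + cover_cost z K.
Proof.
move=> zLP; have JK1 := cover_cost_le1 z (J :|: K).
have J0 := cover_cost_ge0 J zLP; have K0 := cover_cost_ge0 K zLP.
rewrite -lerBlDr; apply: le_cover_cost => [|C JC]; first by lra.
rewrite lerBlDr -lerBlDl.
apply: le_cover_cost => [|C' KC']; first by have := cost_ge0 C zLP; lra.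
rewrite lerBlDl.
(* the union of a cover of J and a cover of K covers J :|: K *)
apply: le_trans (_ : cost z (C.1 :|: C'.1, C.2 :|: C'.2) <= _).
  apply: cover_cost_le; rewrite /covers /= bigcup_setU setUACA.
  exact: setUSS.
rewrite /cost /= addrACA; apply: lerD; apply: sum_setU_le => *;
  exact: compl_ge0.
Qed.

Lemma cover_cost_node (R : realType) (V : finType) (G : hypergraph V)
    (z : point R (edges G)) (v : V) :
  covers_nodes G -> MP_LP z -> cover_cost z [set v] = 1 - z (inl v).
Proof.
move=> cov zLP; apply/eqP; rewrite eq_le; apply/andP; split.
  apply: le_trans (_ : cost z ([set v], set0) <= _).
    by apply: cover_cost_le; rewrite /covers /= subsetUl.
  by rewrite /cost /= big_set1 big_set0 addr0.
apply: le_cover_cost => [|[U T]].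
  by have := MP_LP_node_ge0 v cov zLP; lra.
have z0 p : 0 <= 1 - z p by exact: compl_ge0.
rewrite /covers /cost sub1set /= inE => /orP[vU | /bigcupP[e eT ve]].
  apply: le_trans (le_sum_mem (F := fun v => 1 - z (inl v)) _ vU) _ => //.
  by rewrite lerDl sumr_ge0.
apply: le_trans (_ : 1 - z (inr e) <= _).
  by rewrite lerD2l lerN2 MP_LP_edge_le.
apply: le_trans (le_sum_mem (F := fun e => 1 - z (inr e)) _ eT) _ => //.
by rewrite lerDr sumr_ge0.
Qed.

(** * Covers of an edge and extended flower inequalities *)

(** The nodes of [e0] that belong to [i] but to no other member of [T]. *)
Definition private_part (V : finType) (G : hypergraph V) (e0 : edge G)
    (T : {set edge G}) (i : edge G) : {set V} :=
  (val e0 :&: val i) :\: \bigcup_(j in T :\ i) (val e0 :&: val j).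

Lemma covers_private_part (V : finType) (G : hypergraph V) (e0 i : edge G)
    (U : {set V}) (T : {set edge G}) :
  covers (val e0) (U, T) ->
  covers (val e0) (U :|: private_part e0 T i, T :\ i).
Proof.
move=> /subsetP eUT; apply/subsetP => x xe0; rewrite /= in_setU.
have [/bigcupP[j jT xj] | xT'] :=
  boolP (x \in \bigcup_(j in T :\ i) (val e0 :&: val j)).
  apply/orP; right; apply/bigcupP; exists j => //.
  by move: xj; rewrite inE => /andP[].
have := eUT x xe0; rewrite /= !in_setU => /orP[-> // | /bigcupP[j jT xj]].
have [ij | nij] := eqVneq j i.
  by rewrite in_setD xT' inE xe0 -ij xj orbT.
by case/bigcupP: xT'; exists j; rewrite !inE ?nij ?xe0.
Qed.

(** Replacing [i] by its private part, when this has at most one node [v],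
    does not increase the cost, since [z_i <= z_v]. *)
Lemma cost_private_part (R : realType) (V : finType) (G : hypergraph V)
    (z : point R (edges G)) (e0 i : edge G) (U : {set V}) (T : {set edge G}) :
  MP_LP z -> i \in T -> (#|private_part e0 T i| <= 1)%N ->
  cost z (U :|: private_part e0 T i, T :\ i) <= cost z (U, T).
Proof.
move=> zLP iT Pi1; rewrite /cost /= (big_setD1 i iT) /= addrA lerD2r.
apply: le_trans (sum_setU_le _ _ _) _ => [v|]; first exact: compl_ge0.
rewrite lerD2l; have [->|[v vP]] := set_0Vmem (private_part e0 T i).
  by rewrite big_set0 compl_ge0.
have -> : private_part e0 T i = [set v].
  by apply/eqP; rewrite eq_sym eqEcard sub1set vP cards1.
rewrite big_set1 lerD2l lerN2; apply: MP_LP_edge_le => //.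
by move: vP; rewrite !inE => /and3P[].
Qed.

(** The case where the cover cannot be simplified further: [T] then satisfies
    the condition on neighbors, unless it is empty or contains [e0]. *)
Lemma edge_le_cost_irredundant (R : realType) (V : finType) (G : hypergraph V)
    (z : point R (edges G)) (e0 : edge G) (U : {set V}) (T : {set edge G}) :
  MP_EF z -> covers (val e0) (U, T) ->
  (forall i, i \in T -> (2 <= #|private_part e0 T i|)%N) ->
  1 - z (inr e0) <= cost z (U, T).
Proof.
move=> [zLP zEF] eUT priv.
have z0 p : 0 <= 1 - z p by exact: compl_ge0.
have [e0T | e0T] := boolP (e0 \in T).
  apply: le_trans (le_sum_mem (F := fun e => 1 - z (inr e)) _ e0T) _ => //.
  by rewrite /cost lerDr sumr_ge0.
pose U0 := val e0 :\: \bigcup_(k in T) val k.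
apply: le_trans (_ : cost z (U0, T) <= _); last first.
  rewrite /cost /= lerD2r; apply: sum_subset_le => //.
  by rewrite subDset setUC.
have costE : cost z (U0, T) = #|U0|%:R - \sum_(v in U0) z (inl v)
    + (#|T|%:R - \sum_(k in T) z (inr k)).
  by rewrite /cost /= !sumrB !sumr_const.
rewrite costE; have [T0 | Tn0] := eqVneq T set0.
  have U0E : U0 = val e0 by rewrite /U0 T0 big_set0 setD0.
  have [_ /(_ e0)[_ + _]] := zLP.
  by rewrite U0E T0 big_set0 cards0; lra.
have := zEF e0 T; rewrite /extended_flower_ineq -/U0.
suff flT : flower_neighbors e0 T by move=> /(_ flT); lra.
split=> // i iT.
rewrite /adjacent; apply/andP; split.
  by apply: contraNneq e0T => ->.
rewrite -card_gt0; apply: leq_trans (ltnW (priv i iT)) _.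
exact: subset_leq_card (subsetDl _ _).
Qed.

Lemma edge_le_cost (R : realType) (V : finType) (G : hypergraph V)
    (z : point R (edges G)) (e0 : edge G) (C : {set V} * {set edge G}) :
  MP_EF z -> covers (val e0) C -> 1 - z (inr e0) <= cost z C.
Proof.
case: C => U T zEF; have [n] := ubnP #|T|.
elim: n U T => // n IHn U T Tn eUT.
have [/existsP[i /andP[iT Pi1]] | /existsPn priv] :=
  boolP [exists i, (i \in T) && (#|private_part e0 T i| <= 1)%N].
  apply: le_trans (cost_private_part U zEF.1 iT Pi1).
  apply: IHn; last exact: covers_private_part.
  by move: Tn; rewrite (cardsD1 i) iT.
apply: edge_le_cost_irredundant => // i iT.
by have := priv i; rewrite iT /= -ltnNge.
Qed.

Lemma cover_cost_edge (R : realType) (V : finType) (G : hypergraph V)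
    (z : point R (edges G)) (e : edge G) :
  MP_EF z -> cover_cost z (val e) = 1 - z (inr e).
Proof.
move=> zEF; apply/eqP; rewrite eq_le; apply/andP; split.
  apply: le_trans (_ : cost z (set0, [set e]) <= _).
    by apply: cover_cost_le; rewrite /covers /= big_set1 set0U.
  by rewrite /cost /= big_set1 big_set0 add0r.
apply: le_cover_cost => [|C eC]; last exact: edge_le_cost.
by have := MP_LP_edge_ge0 e zEF.1; lra.
Qed.

(** * The lifted point *)

(** The parts of the chosen partitions are indices of variables, so the dummy
    value of [zset] never occurs in the inequalities of an RMC. *)
Lemma rmc_part (V : finType) (G : hypergraph V) (D : rmc G) (L J : {set V}) :
  L \in edges G :|: rmc_art D -> J \in rmc_split D L ->
  J \in edges G :|: rmc_art D \/ exists v, J = [set v].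
Proof.
move=> LF JL; have [/and3P[_ _ P0] _] := rmc_split_partition LF.
have J0 : (0 < #|J|)%N by rewrite card_gt0; apply: contraNneq P0 => <-.
have [J1 | J1] := ltnP 1 #|J|; last first.
  by right; apply/cards1P; rewrite eqn_leq J1.
left; rewrite in_setU; have [//|JE /=] := boolP (J \in edges G).
apply/rmc_artP; split=> //; move: LF; rewrite in_setU => /orP[LE | LA].
  exists L => //; apply: RecSeqPart JL J1; first exact: RecSeqRoot.
  exact: setU11.
have [[e eE eL] _] := (rmc_artP D L).1 LA.
by exists e => //; apply: RecSeqPart eL _ JL J1; rewrite in_setU LA orbT.
Qed.

Lemma rmc_edge_card (V : finType) (G : hypergraph V) (D : rmc G)
    (L : {set V}) :
  L \in edges G :|: rmc_art D -> (1 < #|L|)%N.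
Proof.
by rewrite in_setU => /orP[]; [exact: edges_card|exact: rmc_art_card].
Qed.

(** The point with node coordinates [z_v] and edge coordinates
    [1 - cover_cost z L]. *)
Definition lift (R : realType) (V : finType) (G : hypergraph V) (D : rmc G)
    (z : point R (edges G)) : point R (edges G :|: rmc_art D) :=
  [ffun p => match p with
             | inl v => z (inl v)
             | inr L => 1 - cover_cost z (val L)
             end].

Lemma zset_lift (R : realType) (V : finType) (G : hypergraph V) (D : rmc G)
    (z : point R (edges G)) (J : {set V}) :
  covers_nodes G -> MP_LP z ->
  J \in edges G :|: rmc_art D \/ (exists v, J = [set v]) ->
  zset (lift D z) J = 1 - cover_cost z J.
Proof.
move=> cov zLP [JF | [v ->]]; rewrite /zset.
  by rewrite insubT ffunE.
rewrite insubN; last first.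
  by apply/negP => /rmc_edge_card; rewrite cards1.
case: pickP => [u /eqP/set1_inj <- | /(_ v)]; last by rewrite eqxx.
by rewrite ffunE cover_cost_node // subKr.
Qed.

Lemma RMC_lift (R : realType) (V : finType) (G : hypergraph V) (D : rmc G)
    (z : point R (edges G)) :
  covers_nodes G -> MP_LP z -> RMC (lift D z).
Proof.
move=> cov zLP L LF J K LJK _.
have part M : M \in [set J; K] ->
    M \in edges G :|: rmc_art D \/ exists v, M = [set v].
  by rewrite -LJK; apply: rmc_part.
rewrite !zset_lift //; [| exact: part (set22 _ _) | exact: part (set21 _ _)
  | by left].
have [/and3P[/eqP] + _ _ _] := rmc_split_partition LF.
rewrite LJK /cover bigcup_setU !big_set1 => <-.
have := cover_cost_subadd J K zLP; have := cover_cost_le1 z (J :|: K).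
have := cover_cost_mono z (subsetUl J K).
have := cover_cost_mono z (subsetUr J K).
by split; lra.
Qed.

Lemma proj_lift (R : realType) (V : finType) (G : hypergraph V) (D : rmc G)
    (z : point R (edges G)) :
  MP_EF z -> proj (lift D z) = z.
Proof.
move=> zEF; apply/ffunP => -[v|e]; rewrite !ffunE //=.
by rewrite (cover_cost_edge e zEF) subKr.
Qed.

Theorem proposition3 (R : realType) (V : finType) (G : hypergraph V)
    (hrank : (3 <= rank G)%N) (hcover : covers_nodes G)
    (D : rmc G) (z : point R (edges G)) :
  MP_EF z -> MP_RMC D z.
Proof.
by move=> zEF; exists (lift D z); [exact: RMC_lift zEF.1 | exact: proj_lift].
Qed.
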